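(* Let $n\ge1$ and let $\mathbf{k}=(k_1,\ldots,k_n)$ be a strictly increasing sequence of positive integers. There exists a (real-valued) probabilistic bijection between the set of mixed six-vertex ($6$V) configurations on the domain $\mathcal{M}_{\mathbf{k}}$ with the weight function $x\mapsto 2^{\widetilde{\mathrm{inv}}(x)}$ and the set of triple-free Gelfand--Tsetlin patterns with bottom row $\mathbf{k}$ with the weight function $T'\mapsto 2^{-n}\,\omega_{\mathrm{FSA}}(T')$.
   Context: **Probabilistic bijections.** Let $X,Y$ be finite sets with weight functions $\omega_X:X\to A$, $\omega_Y:Y\to A$, $A$ a unital algebra (here $A=\mathbb{R}$). A probabilistic bijection from $(X,\omega_X)$ to $(Y,\omega_Y)$ is a pair of maps $\mathcal{P},\overline{\mathcal{P}}:X\times Y\to A$ with (1) $\sum_{y\in Y}\mathcal{P}(x,y)=1$ for each $x\in X$; (2) $\sum_{x\in X}\overline{\mathcal{P}}(x,y)=1$ for each $y\in Y$; (3) $\omega_X(x)\mathcal{P}(x,y)=\overline{\mathcal{P}}(x,y)\omega_Y(y)$ for all $x\in X$, $y\in Y$. **Mixed $6$V configurations.** The domain $\mathcal{M}_{\mathbf{k}}$ in the square lattice $\mathbb{Z}^2$ has vertices $(i,j)$ with $1\le i\le n$ (column $i$) and $1\le j\le 2k_n-1$ (row $j$, counted from the bottom). Internal edges have both endpoints in $\mathcal{M}_{\mathbf{k}}$, boundary edges exactly one. Boundary orientations (with respect to the endpoint in $\mathcal{M}_{\mathbf{k}}$): all north and all south boundary edges are outgoing; all east boundary edges are incoming; on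 the west boundary the horizontal edges in rows $2k_1-1,\ldots,2k_n-1$ are incoming and all others outgoing. A mixed $6$V configuration is an orientation of the internal edges such that every vertex of $\mathcal{M}_{\mathbf{k}}$ has exactly two incoming and two outgoing edges. Call an edge occupied if it is oriented rightward or downward. A vertex is of type (1) if all four incident edges are occupied, and of type (3) if exactly its left and right edges are occupied. The variant inversion number is $\widetilde{\mathrm{inv}}(x)=\mathcal{N}^{\mathrm{even}}_{(1)}(x)+\mathcal{N}^{\mathrm{odd}}_{(3)}(x)$, where $\mathcal{N}^{\mathrm{even}}_{(1)}(x)$ is the number of type-(1) vertices in even rows and $\mathcal{N}^{\mathrm{odd}}_{(3)}(x)$ the number of type-(3) vertices in odd rows. **Triple-free GT patterns.** A Gelfand--Tsetlin (GT) pattern with $n$ rows is a triangular array of integers $T=(T_{i,j})_{1\le j\le i\le n}$ with $T_{i+1,j}\le T_{i,j}\le T_{i+1,j+1}$ for all valid $i,j$; row $n$ is the bottom row. It is triple-free if there is no $(i,j)$ with $T_{i,j}=T_{i,j+1}=T_{i,j+2}$. Its weight is $\omega_{\mathrm{FSA}}(T)=2^{r}$, where $r$ is the number of entries of $T$ that are not equal to both their upper-left and upper-right neighbours (the upper-left and upper-right neighbours of $T_{i,j}$ are $T_{i-1,j-1}$ and $T_{i-1,j}$; an entry lacking one of these is counted in $r$). *)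

(* Defs.v *)
From HB Require Import structures.
From mathcomp Require Import all_boot all_order all_algebra.
From mathcomp Require Import reals.

Set Implicit Arguments.
Unset Strict Implicit.
Unset Printing Implicit Defensive.

Import Order.TTheory GRing.Theory Num.Theory.
Local Open Scope ring_scope.

Definition prob_bijection (A : pzRingType) (X Y : finType)
    (wX : X -> A) (wY : Y -> A) (P Pbar : X -> Y -> A) : Prop :=
  [/\ forall x, \sum_(y : Y) P x y = 1,
      forall y, \sum_(x : X) Pbar x y = 1
    & forall x y, wX x * P x y = Pbar x y * wY y].

Section Mixed6V.
Variables (n : nat) (k : n.-tuple nat).

Definition height : nat := (2 * last 0 k - 1)%N.

(* The vertex (i, j) : 'I_n * 'I_height stands for column i.+1 and row j.+1
   (rows are counted from the bottom).
   An orientation c is recorded on all edges, boundary edges included: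
   c.1 (a, j) is the horizontal edge of row j.+1 joining columns a and a.+1
   (a = 0 on the west boundary, a = n on the east boundary), true if
   oriented rightward; c.2 (i, b) is the vertical edge of column i.+1 joining
   rows b and b.+1 (b = 0 on the south boundary, b = height on the north
   boundary), true if oriented downward.  So true means occupied.  Since the
   boundary orientations are prescribed by boundary_ok, this is the same as
   an orientation of the internal edges. *)
Definition orientation : finType :=
  ({ffun 'I_n.+1 * 'I_height -> bool} * {ffun 'I_n * 'I_height.+1 -> bool})%type.

Implicit Types (c : orientation) (i : 'I_n) (j : 'I_height).

Definition left_occ c i j : bool := c.1 (inord i, j).
Definition right_occ c i j : bool := c.1 (inord i.+1, j).
Definition bottom_occ c i j : bool := c.2 (i, inord j).
Definition top_occ c i j : bool := c.2 (i, inord j.+1).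

Definition indeg c i j : nat :=
  (left_occ c i j + ~~ right_occ c i j + top_occ c i j + ~~ bottom_occ c i j)%N.

Definition outdeg c i j : nat :=
  (~~ left_occ c i j + right_occ c i j + ~~ top_occ c i j + bottom_occ c i j)%N.

Definition boundary_ok c : bool :=
  [&& [forall i, c.2 (i, ord_max) == false],
      [forall i, c.2 (i, ord0) == true],
      [forall j, c.1 (ord_max, j) == false]
    & [forall j : 'I_height,
         c.1 (ord0, j) == (j.+1 \in [seq (2 * m - 1)%N | m <- k])]].

Definition is_mixed6V c : bool :=
  boundary_ok c
  && [forall i, forall j, (indeg c i j == 2%N) && (outdeg c i j == 2%N)].

Definition mixed6V : finType := {c : orientation | is_mixed6V c}.

Definition type1 c i j : bool :=
  [&& left_occ c i j, right_occ c i j, top_occ c i j & bottom_occ c i j].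

Definition type3 c i j : bool :=
  [&& left_occ c i j, right_occ c i j, ~~ top_occ c i j & ~~ bottom_occ c i j].

Definition inv_tilde (x : mixed6V) : nat :=
  (#|[set v : 'I_n * 'I_height | ~~ odd v.2.+1 & type1 (val x) v.1 v.2]|
   + #|[set v : 'I_n * 'I_height | odd v.2.+1 & type3 (val x) v.1 v.2]|)%N.

End Mixed6V.

Section TriangularArrays.
Variable n : nat.

(* Positions (i, j) with 1 <= j <= i <= n, shifted to start from 0. *)
Definition tri : finType := {p : 'I_n * 'I_n | (p.2 <= p.1)%N}.

Implicit Types (a b c : tri) (T : {ffun tri -> int}).

Definition trow a : 'I_n := (val a).1.
Definition tcol a : 'I_n := (val a).2.

Definition upper_left a b : bool :=
  ((trow a).+1 == trow b) && ((tcol a).+1 == tcol b).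

Definition upper_right a b : bool :=
  ((trow a).+1 == trow b) && (tcol a == tcol b).

Definition is_GT T : bool :=
  [forall a, forall b, (upper_right a b ==> (T b <= T a))
                       && (upper_left a b ==> (T a <= T b))].

Definition right_of a b : bool :=
  (trow a == trow b) && ((tcol a).+1 == tcol b).

Definition triple_free T : bool :=
  ~~ [exists a, exists b, exists c,
        [&& right_of a b, right_of b c, T a == T b & T b == T c]].

Definition has_bottom_row (k : n.-tuple nat) T : bool :=
  [forall a, ((trow a).+1 == n) ==> (T a == (tnth k (tcol a))%:Z)].

(* False when b lacks one of its two upper neighbours. *)
Definition equals_both_upper T b : bool :=
  [exists a, upper_left a b && (T a == T b)]
  && [exists a, upper_right a b && (T a == T b)].

Definition FSA_exponent T : nat := #|[set b | ~~ equals_both_upper T b]|.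

End TriangularArrays.

Definition omega_FSA (R : pzRingType) (n : nat) (T : {ffun tri n -> int}) : R :=
  2 ^+ FSA_exponent T.

Section TripleFreeGT.
Variables (n : nat) (k : n.-tuple nat).

Definition is_tfGT (T : {ffun tri n -> int}) : bool :=
  [&& is_GT T, triple_free T & has_bottom_row k T].

Record tfGT : Type := TfGT {
  tfGT_val :> {ffun tri n -> int};
  tfGT_valP : is_tfGT tfGT_val }.

HB.instance Definition _ := [isSub for tfGT_val].
HB.instance Definition _ := [Countable of tfGT by <:].

(* Every entry lies between 0 and the largest entry of k, so there are
   finitely many patterns. *)
Let M : nat := \max_(m <- k) m.

Lemma tfGT_bound (T : {ffun tri n -> int}) (a : tri n) :
  is_tfGT T -> 0 <= T a <= M%:Z.
Proof.
move=> /and3P[/forallP gtT _ /forallP botT].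
have [d] := ubnP (n - trow a)%N; elim: d a => // d IHd a led.
have [eq_n|neq_n] := eqVneq (trow a).+1 n.
  have /implyP/(_ (introT eqP eq_n))/eqP-> := botT a.
  by rewrite !lez_nat /=; exact: (leq_bigmax_seq (F := id)) (mem_tnth _ _) isT.
have lt_n : ((trow a).+1 < n)%N by rewrite ltn_neqAle neq_n ltn_ord.
have le_ca : (tcol a <= trow a)%N by exact: (valP a).
have lt_c : ((tcol a).+1 < n)%N by exact: leq_ltn_trans lt_n.
have tr : ((Ordinal lt_n, tcol a).2 <= (Ordinal lt_n, tcol a).1)%N.
  exact: leqW.
have tl : ((Ordinal lt_n, Ordinal lt_c).2 <= (Ordinal lt_n, Ordinal lt_c).1)%N.
  by [].
pose br : tri n := Sub (Ordinal lt_n, tcol a) tr.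
pose bl : tri n := Sub (Ordinal lt_n, Ordinal lt_c) tl.
have lt_d (b : tri n) : trow b = (trow a).+1 :> nat -> (n - trow b < d)%N.
  move=> ->; rewrite subnS -ltnS prednK ?subn_gt0 //.
have /forallP/(_ br)/andP[/implyP ler _] := gtT a.
have /forallP/(_ bl)/andP[_ /implyP lel] := gtT a.
have /andP[ge0 _] := IHd br (lt_d br erefl).
have /andP[_ leM] := IHd bl (lt_d bl erefl).
rewrite (le_trans ge0 (ler _)) ?(le_trans (lel _) leM) //.
  by rewrite /upper_left /trow /tcol /= !eqxx.
by rewrite /upper_right /trow /tcol /= !eqxx.
Qed.

Let code (T : tfGT) : {ffun tri n -> 'I_M.+1} := [ffun a => inord `|val T a|%N].

Let decode (u : {ffun tri n -> 'I_M.+1}) : option tfGT :=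
  insub [ffun a => (u a : nat)%:Z].

Let codeK : pcancel code decode.
Proof.
move=> T; rewrite /decode -[RHS](valK T); congr insub.
apply/ffunP => a; rewrite !ffunE; have /andP[ge0 leM] := tfGT_bound a (valP T).
by rewrite inordK ?gez0_abs // ltnS -lez_nat gez0_abs.
Qed.

HB.instance Definition _ : isFinite tfGT := PCanIsFinite codeK.

End TripleFreeGT.

(* Main.v *)
Require Import Defs.
From mathcomp Require Import all_boot all_order all_algebra.
From mathcomp Require Import reals.
From mathcomp Require Import zify.

Set Implicit Arguments.
Unset Strict Implicit.
Unset Printing Implicit Defensive.

(** Two positive weight functions on finite sets admit a probabilistic
    bijection as soon as their total masses agree: let both maps ignore their
    source and pick the target with probability proportional to its weight
    (prob_bijection_of_eq_sums).  So the point is the equality of two partition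
    functions (partition_functions),
      sum over x of 2 ^ inv_tilde x = sum over T of 2 ^ (FSA_exponent T - n).

    Both sides are computed by transfer matrices.  A six-vertex configuration
    is a walk of length n through sets of occupied rows, one set for each line
    of horizontal edges, from the west boundary to the empty set at the east
    boundary.  The vertical edges are determined by the rows: since the top
    edge of a column is unoccupied, the vertical edge at a given height is
    occupied iff the left side has one occupied row more than the right side
    above that height.  A triple-free pattern is a walk of length n through
    multisets with multiplicities at most 2, from the bottom row k to the
    empty row.  Two consecutive rows of a Gelfand-Tsetlin pattern interlace iff
    the number of entries above any given threshold drops by 0 or 1 from the
    longer row to the shorter one, which is the same condition as for the
    vertical edges.

    The two walks are related by fusing the rows 2t - 1 and 2t into the single
    value t: a set of rows becomes a multiset of values, in which t has the
    multiplicity 0, 1 or 2.  The fused model has local weights: if the left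
    sides of a pair of rows and the number c of right sides that are occupied
    are fixed, then the total weight of the choices on the right is 2 if c > 0
    and 1 if c = 0, provided that the vertical edges above and below the pair
    exist, and 0 otherwise (sum_pair_weight).  Hence fusion lumps the transfer
    matrix of the six-vertex model (sum_col_weight, path_sum_lump), and the
    fused transfer matrix gives to a row of the pattern the weight
    2 ^ (number of distinct values in this row).

    On the side of the patterns, an entry equals both its upper neighbours iff
    these neighbours are equal, so the entries of one row that are counted by
    FSA_exponent are one more than the distinct values of the row above it.
    Summing over the rows, FSA_exponent T - n is the number of distinct values
    in all rows but the bottom one (FSA_exponentE). *)

(** * Fusion of pairs of rows *)

(** x exceeds y by 0 or 1, the difference being the occupation of an edge. *)
Definition interl (x y : nat) : bool := (y <= x <= y.+1)%N.

(** Weight of the two vertices of one column in rows 2t - 1 and 2t, zero if no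
    orientation of the vertical edges fits.  The pairs a and b give the
    horizontal edges on the left and on the right, the first component being
    the lower row; x and y count the occupied edges on the left and on the
    right in the rows above the pair, so that y < x means that the vertical
    edge above the pair is occupied.  The two factors 2 are those of a type (1)
    vertex in the upper (even) row and of a type (3) vertex in the lower (odd)
    row. *)
Definition pair_weight (x y : nat) (a b : bool * bool) : nat :=
  [&& interl x y, interl (x + a.2) (y + b.2)
    & interl (x + (a.1 + a.2)) (y + (b.1 + b.2))]
  * 2 ^ ([&& a.2, b.2 & y < x] + [&& a.1, b.1 & x + a.2 <= y + b.2]).

(** Weight of the fused vertex, with a occupied edges on the left and c on the
    right, each between 0 and 2. *)
Definition fused_weight (x y a c : nat) : nat :=
  (interl x y && interl (x + a) (y + c)) * 2 ^ (0 < c).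

Lemma sum_pair_weight x y a c : c <= 2 ->
  \sum_(b : bool * bool | b.1 + b.2 == c) pair_weight x y a b
    = fused_weight x y (a.1 + a.2) c.
Proof.
move=> c_le2; rewrite big_mkcond /=.
rewrite (eq_bigr (fun b : bool * bool => if b.1 + b.2 == c then
  pair_weight x y a (b.1, b.2) else 0)) => [|[]//].
rewrite -(pair_bigA _ (fun b1 b2 : bool =>
  if b1 + b2 == c then pair_weight x y a (b1, b2) else 0)) /=.
rewrite !big_bool /= /pair_weight /fused_weight.
case: (boolP (interl x y)) => [/andP[le_yx le_xy]|_]; last first.
  by rewrite !andFb !mul0n !if_same.
have {le_xy le_yx} [->|->] : x = y \/ x = y.+1 by lia.
all: case: a => [[] []]; case: c c_le2 => [|[|[|?]]] // _.
all: rewrite /interl /= ?addSn ?addnS ?addn0 ?add0n ?ltnn ?leqnn ?leqnSn ?andbF ?andbT /=.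
all: try lia.
Qed.

(** The sum of f over the indices that are at least t. *)
Definition tail_sum (K : nat) (f : 'I_K -> nat) (t : nat) : nat :=
  \sum_(s < K | t <= s) f s.

Lemma eq_tail_sum K (f g : 'I_K -> nat) : f =1 g -> tail_sum f =1 tail_sum g.
Proof. by move=> fg t; apply: eq_bigr => s _; rewrite fg. Qed.

Lemma tail_sumE K (f : 'I_K -> nat) (t : 'I_K) :
  tail_sum f t = f t + tail_sum f t.+1.
Proof.
rewrite /tail_sum (bigD1 t) //=; congr (_ + _); apply: eq_bigl => s.
by rewrite [t < s]ltn_neqAle [t == s :> nat]eq_sym andbC.
Qed.

Lemma tail_sum_ge K (f : 'I_K -> nat) t : K <= t -> tail_sum f t = 0.
Proof.
by move=> le_Kt; rewrite /tail_sum big1 // => s; rewrite leqNgt (leq_trans _ le_Kt).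
Qed.

(** Downward induction, for statements about tail sums. *)
Lemma down_ind K (P : nat -> Prop) :
  P K -> (forall t : 'I_K, P t.+1 -> P t) -> forall t, t <= K -> P t.
Proof.
move=> PK Pstep t le_tK; rewrite -(subKn le_tK).
elim: (K - t) (leq_subr t K) => [|d IHd] ltd; first by rewrite subn0.
have lt_dK : K - d.+1 < K by lia.
apply: (Pstep (Ordinal lt_dK)) => /=.
have -> : (K - d.+1).+1 = K - d by lia.
exact/IHd/ltnW.
Qed.

Lemma leq_tail_sum K (f : 'I_K -> nat) s t : s <= t -> tail_sum f t <= tail_sum f s.
Proof.
move=> le_st; rewrite /tail_sum [leqLHS]big_mkcond [leqRHS]big_mkcond /=.
apply: leq_sum => i _; case: ifP => // le_ti.
by rewrite (leq_trans le_st le_ti).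
Qed.

(** The occupied horizontal edges between two columns, the rows 2t + 1 and
    2t + 2 being grouped in the pair of index t, lower row first. *)
Definition col_state (K : nat) := {ffun 'I_K -> bool * bool}.

(** A row of a triple-free pattern: index t has the multiplicity of t + 1. *)
Definition mult_state (K : nat) := {ffun 'I_K -> 'I_3}.

Definition occ (K : nat) (l : col_state K) (t : 'I_K) : nat := (l t).1 + (l t).2.
Definition mult (K : nat) (a : mult_state K) (t : 'I_K) : nat := a t.

(** Transfer matrix of the six-vertex model: the weight of a column with
    horizontal edges l on its left and r on its right.  The first factor says
    that the south edge of the column is occupied. *)
Definition col_weight (K : nat) (l r : col_state K) : nat :=
  (tail_sum (occ l) 0 == (tail_sum (occ r) 0).+1)
  * \prod_(t < K) pair_weight (tail_sum (occ l) t.+1) (tail_sum (occ r) t.+1)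
                              (l t) (r t).

(** Transfer matrix of the fused model. *)
Definition row_weight (K : nat) (a c : mult_state K) : nat :=
  (tail_sum (mult a) 0 == (tail_sum (mult c) 0).+1)
  * \prod_(t < K) fused_weight (tail_sum (mult a) t.+1) (tail_sum (mult c) t.+1)
                              (mult a t) (mult c t).

(** Fusion forgets which of the two rows of a pair is occupied. *)
Definition fuse (K : nat) (l : col_state K) : mult_state K :=
  [ffun t => inord (occ l t)].

Lemma mult_fuse K (l : col_state K) : mult (fuse l) =1 occ l.
Proof.
by move=> t; rewrite /mult ffunE inordK // /occ; case: (l t) => -[] [].
Qed.

Lemma fuse_eqP K (r : col_state K) (c : mult_state K) :
  (fuse r == c) = [forall t, (r t).1 + (r t).2 == c t].
Proof.
apply/eqP/forallP => [<- t|eq_rc]; first by rewrite [X in _ == X]mult_fuse.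
apply/ffunP => t; apply: val_inj; rewrite [LHS]mult_fuse; exact/eqP/eq_rc.
Qed.

(** Once the fused state c on the right is fixed, the vertical edges between
    the pairs are determined, and the choices inside the pairs are
    independent. *)
Lemma sum_col_weight K (l : col_state K) (c : mult_state K) :
  \sum_(r | fuse r == c) col_weight l r = row_weight (fuse l) c.
Proof.
have tl t : tail_sum (mult (fuse l)) t = tail_sum (occ l) t.
  exact/eq_tail_sum/mult_fuse.
pose F (t : 'I_K) b := pair_weight (tail_sum (occ l) t.+1) (tail_sum (mult c) t.+1) (l t) b.
rewrite (eq_bigr (fun r : col_state K =>
    (tail_sum (occ l) 0 == (tail_sum (mult c) 0).+1) *
    \prod_(t < K) F t (r t))); last first.
  move=> r /eqP rc; rewrite /col_weight.
  have tr t : tail_sum (occ r) t = tail_sum (mult c) t.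
    by rewrite -rc; apply/eq_tail_sum => s; rewrite mult_fuse.
  by rewrite tr; congr (_ * _); apply: eq_bigr => t _; rewrite tr.
rewrite -big_distrr /row_weight tl /=; congr (_ * _).
rewrite (eq_bigl (fun r : col_state K =>
  r \in family (fun t => [pred b : bool * bool | b.1 + b.2 == c t]))); last first.
  by move=> r; rewrite fuse_eqP; apply/forallP/familyP.
rewrite -(bigA_distr_big_dep (fun (t : 'I_K) => [pred b : bool * bool | b.1 + b.2 == c t]) F).
apply: eq_bigr => t _.
have c_le2 : c t <= 2 by rewrite -ltnS ltn_ord.
by rewrite tl mult_fuse -/(occ l t) -(sum_pair_weight _ _ (l t) c_le2).
Qed.

(** * Weighted walks *)

(** The weight of the walk from b through the states of p, zero unless the
    walk ends in z. *)
Fixpoint path_weight (S : eqType) (U : S -> S -> nat) (z b : S) (p : seq S) : nat :=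
  if p is x :: p' then U b x * path_weight U z x p' else b == z.

Lemma path_weightE (S : eqType) (U : S -> S -> nat) (z b : S) (p : seq S) :
  path_weight U z b p =
  (\prod_(i < size p) U (nth b (b :: p) i) (nth b p i)) * (last b p == z).
Proof.
elim: p b => [|x p IHp] b /=; first by rewrite big_ord0 mul1n.
rewrite big_ord_recl /= -mulnA IHp; congr (_ * (_ * _)).
apply: eq_bigr => i _; congr (U _ _); last by apply: set_nth_default.
by apply: set_nth_default => /=; rewrite ltnS ltnW.
Qed.

(** The a-th state of the walk from b through p; b is the state of index 0. *)
Definition walk (S : eqType) (b : S) (p : seq S) (a : nat) : S := nth b (b :: p) a.

Lemma path_weight_walk (S : eqType) (U : S -> S -> nat) (z b : S) n (p : n.-tuple S) :
  path_weight U z b p =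
  (\prod_(i < n) U (walk b p i) (walk b p i.+1)) * (walk b p n == z).
Proof. by rewrite path_weightE (last_nth b) size_tuple. Qed.

Lemma walk_mktuple (S : eqType) (f : nat -> S) n a : a <= n ->
  walk (f 0) [tuple f i.+1 | i < n] a = f a.
Proof.
case: a => // a lt_an.
by have := tnth_mktuple (fun i : 'I_n => f i.+1) (Ordinal lt_an); rewrite (tnth_nth (f 0)).
Qed.

(** Total weight of the walks of length n from b to z. *)
Definition path_sum (S : finType) (U : S -> S -> nat) (z : S) (n : nat) (b : S) : nat :=
  \sum_(p : n.-tuple S) path_weight U z b p.

Lemma path_sum0 (S : finType) (U : S -> S -> nat) (z b : S) :
  path_sum U z 0 b = (b == z).
Proof.
rewrite /path_sum (big_pred1 [tuple]) // => p.
by apply/esym/eqP; apply: tuple0.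
Qed.

Lemma path_sumS (S : finType) (U : S -> S -> nat) (z : S) (n : nat) (b : S) :
  path_sum U z n.+1 b = \sum_x U b x * path_sum U z n x.
Proof.
under [RHS]eq_bigr do rewrite /path_sum big_distrr.
rewrite pair_bigA /path_sum /=.
rewrite (reindex (fun q : S * n.-tuple S => cons_tuple q.1 q.2)) //=.
exists (fun p : n.+1.-tuple S => (thead p, behead_tuple p)) => [[x p]|p] _ /=.
  by congr (_, _); apply: val_inj.
by case/tupleP: p => x p; apply: val_inj.
Qed.

(** Lumping: if the weight U of the steps from l into a fibre of f depends on l
    through f l only, the walks with weight U may be counted by their images. *)
Lemma path_sum_lump (S S' : finType) (U : S -> S -> nat) (V : S' -> S' -> nat)
    (f : S -> S') (z : S) (z' : S') (n : nat) (b : S) :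
    (forall l c, \sum_(r | f r == c) U l r = V (f l) c) ->
    (forall l, (f l == z') = (l == z)) ->
  path_sum U z n b = path_sum V z' n (f b).
Proof.
move=> UV fz; elim: n b => [|n IHn] b.
  by rewrite !path_sum0 fz.
rewrite !path_sumS; under [RHS]eq_bigr do rewrite -UV big_distrl.
rewrite (exchange_big_dep xpredT) //=; apply: eq_bigr => r _.
by rewrite (big_pred1 (f r)) ?IHn // => c; rewrite eq_sym.
Qed.

(** An injection onto the support of W that respects weights preserves the
    total. *)
Lemma sum_injective_support (X Y : finType) (h : X -> Y) (w : X -> nat) (W : Y -> nat) :
    injective h -> (forall x, W (h x) = w x) ->
    (forall y, W y != 0 -> exists x, h x = y) ->
  \sum_x w x = \sum_y W y.
Proof.
move=> h_inj hW h_onto.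
rewrite (partition_big h xpredT) //=; apply: eq_bigr => y _.
have [Wy0|/h_onto[x <-]] := eqVneq (W y) 0.
  by rewrite Wy0 big1 // => x /eqP hx; rewrite -hW hx.
by rewrite (big_pred1 x) ?hW // => x'; rewrite (inj_eq h_inj).
Qed.

(** * Six-vertex configurations as walks *)

(** Occupation of row q, counted from 0; false from row 2K on. *)
Definition bit (K : nat) (s : col_state K) (q : nat) : bool :=
  if insub q./2 is Some t then (if odd q then (s t).2 else (s t).1) else false.

Lemma bit_double K (s : col_state K) (t : 'I_K) : bit s t.*2 = (s t).1.
Proof. by rewrite /bit odd_double doubleK valK. Qed.

Lemma bit_doubleS K (s : col_state K) (t : 'I_K) : bit s t.*2.+1 = (s t).2.
Proof. by rewrite /bit /= uphalf_double odd_double valK. Qed.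

Lemma col_state_eq K (s s' : col_state K) :
  (forall q, q < K.*2 -> bit s q = bit s' q) -> s = s'.
Proof.
move=> eqb; apply/ffunP => t; have lt_tK := ltn_ord t.
rewrite [s t]surjective_pairing [s' t]surjective_pairing.
by rewrite -!bit_double -!bit_doubleS !eqb //; lia.
Qed.

(** Number of occupied rows q' >= q. *)
Definition row_tail (K : nat) (s : col_state K) (q : nat) : nat :=
  (odd q && bit s q) + tail_sum (occ s) (uphalf q).

Lemma row_tailE K (s : col_state K) (q : nat) : q < K.*2 ->
  row_tail s q = bit s q + row_tail s q.+1.
Proof.
move=> lt_qK; rewrite /row_tail.
have [t [->|->]] : exists t : 'I_K, q = t.*2 \/ q = t.*2.+1.
- have lt_q2 : q./2 < K by lia.
  by exists (Ordinal lt_q2) => /=; lia.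
- have -> : uphalf t.*2.+1 = t.+1 by lia.
  rewrite uphalf_double odd_double /= odd_double /= add0n tail_sumE /occ.
  by rewrite bit_double bit_doubleS addnA.
- have -> : uphalf t.*2.+2 = t.+1 by lia.
  have -> : uphalf t.*2.+1 = t.+1 by lia.
  by rewrite /= odd_double /=.
Qed.

Lemma row_tail_double K (s : col_state K) (t : nat) :
  row_tail s t.*2 = tail_sum (occ s) t.
Proof. by rewrite /row_tail odd_double uphalf_double. Qed.

Lemma row_tail_end K (s : col_state K) : row_tail s K.*2 = 0.
Proof. by rewrite row_tail_double tail_sum_ge. Qed.

(** The weight of a pair in terms of its two rows, L and R being the numbers of
    occupied edges on the left and on the right from a given row upwards. *)
Lemma pair_weight_rows K (l r : col_state K) (t : 'I_K) :
  let L := row_tail l in let R := row_tail r in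
  pair_weight (tail_sum (occ l) t.+1) (tail_sum (occ r) t.+1) (l t) (r t) =
  [&& interl (L t.*2.+2) (R t.*2.+2), interl (L t.*2.+1) (R t.*2.+1)
    & interl (L t.*2) (R t.*2)]
  * 2 ^ ([&& bit l t.*2.+1, bit r t.*2.+1 & R t.*2.+2 < L t.*2.+2]
       + [&& bit l t.*2, bit r t.*2 & L t.*2.+1 <= R t.*2.+1]).
Proof.
have lt_t := ltn_ord t.
have E s : row_tail s t.*2.+1 = tail_sum (occ s) t.+1 + (s t).2.
  by rewrite row_tailE ?bit_doubleS -?doubleS ?row_tail_double 1?addnC //; lia.
rewrite /= !E -doubleS !row_tail_double !tail_sumE !bit_double !bit_doubleS.
by rewrite ![occ _ _ + _]addnC.
Qed.

Lemma card_pred_sum (T : finType) (P : pred T) : #|[set v | P v]| = \sum_v P v.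
Proof. by rewrite cardsE -sum1_card big_mkcond. Qed.

Section Encoding.
Variables (n : nat) (k : n.-tuple nat).
Local Notation K := (last 0 k).
Hypothesis K_gt0 : 0 < K.
Hypothesis k_pos : forall m : nat, m \in k -> 0 < m.
Hypothesis k_max : forall m : nat, m \in k -> m <= K.

Implicit Types (c : orientation k) (i : 'I_n).

(** Occupation of the horizontal edge to the right of column a in row q,
    counted from 0 (a = 0 is the west boundary); false above the domain. *)
Definition hor c (a q : nat) : bool :=
  if insub q is Some j then c.1 (inord a, j) else false.

(** Occupation of the vertical edge of column i below row q, counted from 0;
    false at the north boundary and above. *)
Definition ver c i (b : nat) : bool :=
  (b < height k) && c.2 (i, inord b).

(** The domain has the odd height 2K - 1, so its edges are completed by an
    unoccupied row 2K. *)
Definition column c (i : nat) : col_state K :=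
  [ffun t : 'I_K => (hor c i t.*2, hor c i t.*2.+1)].

(** The horizontal edges of the west boundary: row 2m - 1 is the lower row of
    the pair of index m - 1. *)
Definition west : col_state K := [ffun t : 'I_K => ((t : nat).+1 \in k, false)].

(** The horizontal edges of the east boundary. *)
Definition empty_column : col_state K := [ffun => (false, false)].

(** The walk that encodes a configuration, west boundary excluded. *)
Definition columns c : n.-tuple (col_state K) :=
  [tuple column c i.+1 | i < n].

Let heightE : (height k).+1 = K.*2.
Proof. by rewrite /height; lia. Qed.

Lemma hor_ge c a q : height k <= q -> hor c a q = false.
Proof. by move=> le_hq; rewrite /hor insubF // ltnNge le_hq. Qed.

Lemma hor_ord c a (j : 'I_(height k)) : hor c a j = c.1 (inord a, j).
Proof. by rewrite /hor valK. Qed.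

Lemma bit_column c a q : bit (column c a) q = hor c a q.
Proof.
rewrite /bit; case: insubP => [t _ tE|]; last first.
  by rewrite -leqNgt => le_K; rewrite hor_ge //; lia.
rewrite ffunE /= tE -[q in RHS]odd_double_half.
by case: (odd q).
Qed.

Lemma bit_empty q : bit empty_column q = false.
Proof. by rewrite /bit; case: insubP => // t _ _; rewrite ffunE; case: ifP. Qed.

Lemma bit_west q : bit west q = (q.+1 \in [seq (2 * m - 1)%N | m <- k]).
Proof.
apply/idP/mapP => [|[m mk qE]].
  rewrite /bit; case: insubP => // t _ tE; rewrite ffunE /=.
  case: ifP => // q_even tk; exists (t : nat).+1 => //.
  by move: tE => /=; lia.
have m_gt0 := k_pos mk; have le_mK := k_max mk.
have lt_mK : m.-1 < K by lia.
have -> : q = (Ordinal lt_mK).*2 by rewrite /=; lia.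
by rewrite bit_double ffunE /= prednK.
Qed.

(** The ice rule at a vertex is the conservation of the number of occupied
    edges, left and top on one side, right and bottom on the other; it holds
    trivially above the domain. *)
Lemma mixed6VP c : reflect
  [/\ forall i, ver c i 0, forall q, q < height k -> bit west q = hor c 0 q,
      forall q, hor c n q = false, forall i, c.2 (i, ord_max) = false &
      forall i q, hor c i q + ver c i q.+1 = hor c i.+1 q + ver c i q]
  (is_mixed6V c).
Proof.
have lth : 0 < height k by lia.
have ver0 i : ver c i 0 = c.2 (i, ord0).
  rewrite /ver lth; congr (c.2 (_, _)); apply: val_inj; exact: inordK.
have ver_h i q : q < height k -> ver c i q = c.2 (i, inord q).
  by rewrite /ver => ->.
have ver_top i (top0 : forall i, c.2 (i, ord_max) = false) q : q < height k ->
  ver c i q.+1 = c.2 (i, inord q.+1).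
  rewrite /ver leq_eqVlt => /predU1P[->|-> //].
  rewrite ltnn /= -(top0 i); congr (c.2 (_, _)); apply: val_inj.
  by rewrite /= inordK.
have horE (a : nat) (q : 'I_(height k)) : hor c a q = c.1 (inord a, q) by rewrite hor_ord.
have vtx i (j : 'I_(height k)) (top0 : forall i, c.2 (i, ord_max) = false) :
   ((indeg c i j == 2) && (outdeg c i j == 2)) =
   (hor c i j + ver c i j.+1 == hor c i.+1 j + ver c i j).
  rewrite !horE ver_top // ver_h // /indeg /outdeg /left_occ /right_occ /bottom_occ /top_occ.
  by case: (c.1 (inord i, j)); case: (c.1 (inord i.+1, j));
    case: (c.2 (i, inord j)); case: (c.2 (i, inord j.+1)).
apply: (iffP andP) => [[/and4P[/forallP top /forallP bot /forallP east /forallP wst]] vt|].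
  have top0 i : c.2 (i, ord_max) = false by apply/eqP/top.
  split=> // [i|q qh|q|i q].
  - by rewrite ver0; apply/eqP/bot.
  - rewrite (horE 0 (Ordinal qh)) bit_west.
    have /eqP <- := wst (Ordinal qh); congr (c.1 (_, _)); apply: val_inj.
    by rewrite /= inordK.
  - have [qh|] := ltnP q (height k); last exact: hor_ge.
    rewrite (horE n (Ordinal qh)).
    have /eqP <- := east (Ordinal qh); congr (c.1 (_, _)); apply: val_inj.
    by rewrite /= inordK.
  - have [qh|le_hq] := ltnP q (height k).
      have /forallP/(_ i)/forallP/(_ (Ordinal qh)) := vt.
      by rewrite vtx // => /eqP.
    by rewrite !hor_ge // /ver ltnNge leqW // ltnNge le_hq.
case=> south wst east top0 vt; split; last first.
  by apply/forallP=> i; apply/forallP => j; rewrite vtx // vt.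
apply/and4P; split; apply/forallP => i.
- exact/eqP.
- by rewrite -ver0 south.
- have -> : ord_max = inord n :> 'I_n.+1 by apply: val_inj; rewrite /= inordK.
  by rewrite -horE east.
- have -> : ord0 = inord 0 :> 'I_n.+1 by apply: val_inj; rewrite /= inordK.
  by rewrite -horE -wst // bit_west.
Qed.

(** Conservation from row q upwards determines the vertical edges. *)
Lemma column_tail c i q : is_mixed6V c -> q <= K.*2 ->
  row_tail (column c i) q = row_tail (column c i.+1) q + ver c i q.
Proof.
case/mixed6VP=> _ _ _ _ vt; move: q; apply: down_ind => [|q IHq].
  by rewrite !row_tail_end /ver ltnNge -heightE leqnSn.
rewrite (row_tailE (column c i) (ltn_ord q)) (row_tailE (column c i.+1) (ltn_ord q)).
by rewrite IHq !bit_column; have := vt i q; lia.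
Qed.

Local Notation state := (walk west).

Lemma column0 c : is_mixed6V c -> column c 0 = west.
Proof.
case/mixed6VP=> _ wst _ _ _; apply: col_state_eq => q ltq; rewrite bit_column.
have [/wst-> //|le_hq] := ltnP q (height k).
rewrite hor_ge //; have -> : q = (height k) by lia.
apply/esym; rewrite bit_west; apply/mapP => -[m mk]; have := k_pos mk.
rewrite /height; lia.
Qed.

Lemma column_end c : is_mixed6V c -> column c n = empty_column.
Proof.
case/mixed6VP=> _ _ est _ _; apply: col_state_eq => q ltq.
by rewrite bit_column est bit_empty.
Qed.

Lemma state_columns c a : is_mixed6V c -> a <= n -> state (columns c) a = column c a.
Proof.
by move=> cP le_an; rewrite -(column0 cP) walk_mktuple.
Qed.

(** The contribution of a vertex to the inversion number.  Row q is counted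
    from 0, so odd q stands for an even row.  The bottom edge need not be
    tested, by conservation. *)
Definition row_inv c i q : bool :=
  [&& hor c i q, hor c i.+1 q & if odd q then ver c i q.+1 else ~~ ver c i q.+1].

Lemma pair_weight_column c i (t : 'I_K) : is_mixed6V c ->
  pair_weight (tail_sum (occ (column c i)) t.+1) (tail_sum (occ (column c i.+1)) t.+1)
    (column c i t) (column c i.+1 t) = 2 ^ (row_inv c i t.*2.+1 + row_inv c i t.*2).
Proof.
move=> cP; have lt_t := ltn_ord t.
have [t2 t1 t0] : [/\ t.*2.+2 <= K.*2, t.*2.+1 <= K.*2 & t.*2 <= K.*2] by split; lia.
rewrite pair_weight_rows !bit_column.
rewrite (column_tail i cP t2) (column_tail i cP t1) (column_tail i cP t0).
have inE y (v : bool) : interl (y + v) y by case: v; rewrite /interl; lia.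
have ltE y (v : bool) : (y < y + v) = v by case: v; lia.
have leE y (v : bool) : (y + v <= y) = ~~ v by case: v; lia.
by rewrite !inE ltE leE mul1n /row_inv /= odd_double.
Qed.

Lemma sum_doubled (f : nat -> nat) m :
  \sum_(t < m) (f t.*2.+1 + f t.*2) = \sum_(q < m.*2) f q.
Proof.
elim: m => [|m IHm]; first by rewrite !big_ord0.
by rewrite doubleS !big_ord_recr /= IHm -addnA [f _ + f _]addnC.
Qed.

Lemma inv_tildeE (x : mixed6V k) :
  inv_tilde x = \sum_(i < n) \sum_(q < K.*2) row_inv (val x) i q.
Proof.
have /mixed6VP[_ _ _ top0 vt] := valP x; set c := val x in vt top0 *.
rewrite /inv_tilde !card_pred_sum -big_split /=.
rewrite (eq_bigr (fun v : 'I_n * 'I_(height k) => row_inv c v.1 v.2 : nat)); last first.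
  case=> i j _ /=.
  have := vt i j; have := hor_ord c i j; have := hor_ord c i.+1 j.
  rewrite /row_inv /type1 /type3 /left_occ /right_occ /top_occ /bottom_occ => -> ->.
  have -> : ver c i j.+1 = c.2 (i, inord j.+1).
    rewrite /ver; have := ltn_ord j; rewrite leq_eqVlt => /predU1P[eq_j|-> //].
    rewrite eq_j ltnn /= -(top0 i); congr (c.2 (_, _)); apply: val_inj.
    by rewrite /= inordK.
  have -> : ver c i j = c.2 (i, inord j) by rewrite /ver ltn_ord.
  by case: (odd j); case: (c.1 (inord i, j)); case: (c.1 (inord i.+1, j));
    case: (c.2 (i, inord j)); case: (c.2 (i, inord j.+1)).
rewrite -(pair_bigA _ (fun (i : 'I_n) (j : 'I_(height k)) => row_inv c i j : nat)) /=.
apply: eq_bigr => i _; rewrite -heightE big_ord_recr /= [X in _ + X](_ : _ = 0) ?addn0 //.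
by rewrite /row_inv hor_ge.
Qed.

Lemma path_weight_columns (x : mixed6V k) :
  path_weight (@col_weight K) empty_column west (columns (val x)) = 2 ^ inv_tilde x.
Proof.
rewrite inv_tildeE; have := valP x; move: (val x) => c cP.
have /mixed6VP[south _ _ _ _] := cP.
rewrite path_weight_walk.
rewrite state_columns // column_end // eqxx muln1 expn_sum; apply: eq_bigr => i _.
rewrite !state_columns // ?(ltnW (ltn_ord i)) // /col_weight.
rewrite -!(row_tail_double _ 0) (column_tail i cP (leq0n _)) south addn1 eqxx mul1n.
rewrite -(sum_doubled (fun q => row_inv c i q : nat)) expn_sum; apply: eq_bigr => t _.
exact: pair_weight_column.
Qed.

Lemma columns_inj c c' :
  is_mixed6V c -> is_mixed6V c' -> columns c = columns c' -> c = c'.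
Proof.
move=> cP c'P eqcc.
have eqcol a : a <= n -> column c a = column c' a.
  by move=> le_an; rewrite -!state_columns // eqcc.
have eqhor a q : a <= n -> hor c a q = hor c' a q.
  by move=> le_an; rewrite -!bit_column eqcol.
have lt_n i : i <= n by apply: ltnW.
have eqver i q : q <= K.*2 -> ver c i q = ver c' i q.
  move=> le_q; have := column_tail i cP le_q; have := column_tail i c'P le_q.
  rewrite !eqcol // => -> /addnI.
  by case: (ver c i q); case: (ver c' i q).
rewrite [c]surjective_pairing [c']surjective_pairing; congr (_, _); apply/ffunP.
  case=> a j; have := eqhor a j; rewrite !hor_ord inord_val; apply.
  by rewrite -ltnS.
case=> i b; have [lt_bh|le_hb] := ltnP b (height k).
  have := eqver i b; rewrite /ver lt_bh inord_val; apply; lia.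
have -> : b = ord_max by apply: val_inj; apply/eqP; rewrite eqn_leq -ltnS ltn_ord.
by case/mixed6VP: cP => _ _ _ -> _; case/mixed6VP: c'P => _ _ _ -> _.
Qed.

(** The configuration encoded by a walk, vertical edges being recovered from
    conservation. *)
Definition decode_columns (p : seq (col_state K)) : orientation k :=
  ([ffun aj : 'I_n.+1 * 'I_(height k) => bit (state p aj.1) aj.2],
   [ffun ib : 'I_n * 'I_(height k).+1 =>
      row_tail (state p ib.1.+1) ib.2 < row_tail (state p ib.1) ib.2]).

Lemma columns_onto (p : n.-tuple (col_state K)) :
  path_weight (@col_weight K) empty_column west p != 0 ->
  exists2 c, is_mixed6V c & columns c = p.
Proof.
rewrite path_weight_walk muln_eq0 negb_or => /andP[].
rewrite eqb0 negbK => pw /eqP p_end.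
have {pw} step i : col_weight (state p i) (state p i.+1) != 0.
  by apply: contraNneq pw => w0; rewrite (bigD1 i) //= w0.
have start i : row_tail (state p i) 0 = (row_tail (state p i.+1) 0).+1.
  rewrite !(row_tail_double _ 0); have := step i.
  rewrite /col_weight muln_eq0 negb_or eqb0 negbK.
  by case/andP=> /eqP.
have inter i q : q <= K.*2 -> interl (row_tail (state p i) q) (row_tail (state p i.+1) q).
  rewrite leq_eqVlt => /predU1P[->|lt_q]; first by rewrite !row_tail_end.
  have lt_q2 : q./2 < K by lia.
  have := step i; rewrite /col_weight muln_eq0 negb_or => /andP[_].
  rewrite (bigD1 (Ordinal lt_q2)) // muln_eq0 negb_or pair_weight_rows => /andP[+ _].
  rewrite muln_eq0 eqb0 negb_or negbK => /andP[/and3P[_ i1 i0] _].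
  have [->|->] : q = q./2.*2 \/ q = q./2.*2.+1 by lia.
    exact: i0.
  exact: i1.
(* The added top row is unoccupied in the west, and it stays so in each step, as
   the top vertical edge would otherwise have a negative occupation number. *)
have dummy a : a <= n -> row_tail (state p a) (height k) = 0.
  elim: a => [_|a IHa lt_an].
    rewrite row_tailE ?heightE ?row_tail_end; last by lia.
    rewrite bit_west; case: mapP => // -[m mk]; have := k_pos mk.
    by rewrite /height; lia.
  have := inter (Ordinal lt_an) (height k); rewrite /interl /= IHa ?(ltnW lt_an) //.
  by rewrite leqn0 => /(_ _)/andP[|/eqP//]; lia.
pose c := decode_columns p.
have horE a q : a <= n -> q < height k -> hor c a q = bit (state p a) q.
  by move=> le_an lt_q; rewrite (hor_ord c a (Ordinal lt_q)) ffunE /= inordK.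
have verE i q : q <= height k ->
    ver c i q = (row_tail (state p i.+1) q < row_tail (state p i) q).
  rewrite leq_eqVlt /ver => /predU1P[->|lt_q].
    by rewrite ltnn dummy ?(dummy i) // ltnW.
  by rewrite lt_q ffunE /= inordK // ltnW.
have bit_dummy a q : a <= n -> height k <= q -> bit (state p a) q = false.
  move=> le_an; rewrite leq_eqVlt => /predU1P[<-|lt_q]; last first.
    by rewrite /bit insubF //; lia.
  have := dummy _ le_an; rewrite row_tailE; last by lia.
  by case: bit.
have horE' a q : a <= n -> hor c a q = bit (state p a) q.
  move=> le_an; have [/(horE _ _ le_an)//|le_hq] := ltnP q (height k).
  by rewrite hor_ge // bit_dummy.
have lt_n i : i <= n by apply: ltnW.
exists c; last first.
  apply: eq_from_tnth => i; rewrite tnth_mktuple; apply: col_state_eq => q _.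
  by rewrite bit_column horE' // (tnth_nth west).
apply/mixed6VP; split=> [i|q lt_q|q|i|i q].
- by rewrite verE // start.
- by rewrite horE'.
- by rewrite horE' // p_end bit_empty.
- by rewrite ffunE /= dummy ?(dummy i).
have [lt_q|le_q] := ltnP q (height k); last first.
  by rewrite !hor_ge // /ver ltnNge leqW // ltnNge le_q.
have lt_qK : q < K.*2 by lia.
rewrite !horE' // !verE //; last exact: ltnW.
have := inter i q (ltnW lt_qK); have := inter i q.+1 lt_qK.
rewrite (row_tailE (state p i) lt_qK) (row_tailE (state p i.+1) lt_qK) /interl.
by case: (bit (state p i) q); case: (bit (state p i.+1) q); lia.
Qed.

End Encoding.

(** * Nondecreasing rows and their multiplicities *)

(** An upward closed set of indices below m is determined by its size. *)
Lemma count_up_closed (P : nat -> bool) m :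
    (forall g g', g <= g' < m -> P g -> P g') ->
  forall g, g < m -> P g = (m <= \sum_(i < m) P i + g).
Proof.
elim: m => // m IHm Pup g; rewrite big_ord_recr /=.
have [Pm|nPm] := boolP (P m); last first.
  have nP i : i <= m -> P i = false.
    by move=> le_im; apply: contraNF nPm; apply: Pup; rewrite le_im /=.
  move=> lt_g; rewrite nP // big1 => [|i _]; first by lia.
  by rewrite nP // ltnW.
rewrite ltnS leq_eqVlt => /predU1P[->|lt_gm]; first by rewrite Pm; lia.
rewrite IHm // ?addn1 ?addSn //.
by move=> i j lt_ij; apply: Pup; lia.
Qed.

Lemma count_down_closed (P : nat -> bool) m :
    (forall g g', g <= g' < m -> P g' -> P g) ->
  forall g, g < m -> P g = (g < \sum_(i < m) P i).
Proof.
move=> Pdown g lt_gm.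
have PE := @count_up_closed (fun i => ~~ P i) m _ g lt_gm.
rewrite -[P g]negbK PE => [|i j lt_ij]; last exact/contraNN/Pdown.
have : \sum_(i < m) ~~ P i + \sum_(i < m) P i = m.
  rewrite -big_split /= -[RHS]card_ord -sum1_card.
  by apply: eq_bigr => i _; case: (P i).
by lia.
Qed.

Lemma sum_geq m c : \sum_(g < m) (c <= g) = m - c.
Proof.
elim: m => [|m IHm]; first by rewrite big_ord0.
by rewrite big_ord_recr /= IHm; case: leqP; lia.
Qed.

(** The number of entries above the threshold t in the row f of size m. *)
Definition row_above (f : nat -> nat) m t : nat := \sum_(g < m) (t < f g).

(** The multiplicity of t + 1 in the row f of size m. *)
Definition row_mult (f : nat -> nat) m t : nat := \sum_(g < m) (f g == t.+1).

Lemma row_aboveS f m t : row_above f m t = row_mult f m t + row_above f m t.+1.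
Proof. by rewrite /row_above /row_mult -big_split; apply: eq_bigr => g _ /=; lia. Qed.

Definition nondecr_row (f : nat -> nat) m := forall g g', g <= g' < m -> f g <= f g'.

(** A nondecreasing row is determined by the numbers of its entries above the
    thresholds, which form the conjugate partition. *)
Lemma row_aboveP f m g t : nondecr_row f m -> g < m ->
  (t < f g) = (m <= row_above f m t + g).
Proof.
move=> fP lt_gm; apply: (@count_up_closed (fun g => t < f g) m) => // i j lt_ij.
by move/leq_trans; apply; apply: fP.
Qed.

Lemma row_mult_le2 f m t : nondecr_row f m ->
  (forall g, g.+2 < m -> f g < f g.+2) -> row_mult f m t <= 2.
Proof.
move=> fP f3; rewrite leqNgt; apply/negP => gt2.
have le_m : row_above f m t <= m.
  rewrite -[leqRHS]card_ord -sum1_card; apply: leq_sum => i _; exact: leq_b1.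
have := row_aboveS f m t => tE.
(* The first entry above t; if t + 1 had multiplicity 3 or more, the entry two
   places further would still be t + 1. *)
pose g := m - row_above f m t.
have lt_g : g.+2 < m by rewrite /g; lia.
have := f3 _ lt_g.
have := @row_aboveP f m g t fP; have := @row_aboveP f m g.+2 t.+1 fP lt_g.
rewrite /g; lia.
Qed.

(** The distinct values of a nondecreasing row, counted on the one hand by the
    values that occur and on the other hand by the ascents. *)
Lemma distinct_row f m K : nondecr_row f m.+1 -> (forall g, g <= m -> 0 < f g <= K) ->
  \sum_(t < K) (0 < row_mult f m.+1 t) = (\sum_(g < m) (f g != f g.+1)).+1.
Proof.
have one x : 0 < x <= K -> \sum_(t < K) (x == t.+1) = 1.
  move=> /andP[x_gt0 le_x]; have lt_x : x.-1 < K by lia.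
  rewrite (bigD1 (Ordinal lt_x)) //= big1 ?prednK ?eqxx // => t neq_t.
  apply/eqP; rewrite eqb0; apply: contraNneq neq_t => xE; apply/eqP/val_inj => /=.
  by rewrite xE.
elim: m => [|m IHm] fP fK.
  rewrite big_ord0 -[RHS](one (f 0)) ?fK //; apply: eq_bigr => t _.
  by rewrite /row_mult big_ord_recl big_ord0 addn0; case: eqP.
rewrite big_ord_recr /= -addSn -IHm; first last.
- by move=> g le_g; apply: fK; lia.
- by move=> g g' lt_g; apply: fP; lia.
have eqS t : row_mult f m.+2 t = row_mult f m.+1 t + (f m.+1 == t.+1).
  by rewrite /row_mult big_ord_recr.
under eq_bigr => t _ do rewrite eqS.
have [eq_f|neq_f] := eqVneq (f m) (f m.+1).
  rewrite addn0; apply: eq_bigr => t _; rewrite -eq_f.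
  by rewrite [row_mult f m.+1 t]big_ord_recr /=; case: (f m == t.+1); lia.
rewrite -[X in _ = _ + X](one (f m.+1)) ?fK // -big_split; apply: eq_bigr => t _ /=.
case: eqP => [fE|]; last by rewrite !addn0.
rewrite [row_mult f m.+1 t]big1 // => g _; apply/eqP; rewrite eqb0 -fE.
have := fP g m; have := fP m m.+1; have := ltn_ord g; lia.
Qed.

(** The multiplicities of the row f of size m.  They are assumed to be at most
    2: larger ones are not represented. *)
Definition row_state (K : nat) (f : nat -> nat) m : mult_state K :=
  [ffun t : 'I_K => inord (row_mult f m t)].

Lemma row_state_mult K f m (t : 'I_K) : row_mult f m t <= 2 ->
  mult (row_state K f m) t = row_mult f m t.
Proof. by move=> le2; rewrite /mult ffunE inordK. Qed.

Lemma row_state_tail K f m t :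
    (forall s, row_mult f m s <= 2) -> (forall g, g < m -> f g <= K) -> t <= K ->
  tail_sum (mult (row_state K f m)) t = row_above f m t.
Proof.
move=> le2 fK; move: t; apply: down_ind => [|t IHt].
  rewrite tail_sum_ge // /row_above big1 // => g _.
  by rewrite ltnNge fK.
by rewrite tail_sumE IHt row_state_mult // -row_aboveS.
Qed.

(** * Triple-free patterns as walks *)

Section Patterns.
Variables (n : nat) (k : n.+1.-tuple nat).
Local Notation K := (last 0 k).
Hypothesis k_gt0 : forall g, g < n.+1 -> 0 < nth 0 k g.
Hypothesis k_leK : forall g, g < n.+1 -> nth 0 k g <= K.
Hypothesis k_incr : forall g g', g < g' < n.+1 -> nth 0 k g < nth 0 k g'.

(** Triple-free patterns with bottom row k, as functions of natural numbers:
    e m g is the entry of index g, counted from 0, in the row of size m, for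
    g < m <= n.+1.  Triple-freeness is stated as a strict inequality, which is
    equivalent as the rows are nondecreasing. *)
Definition tf_pattern (e : nat -> nat -> nat) : Prop :=
  [/\ forall m g, g < m <= n.+1 -> 0 < e m g <= K,
      forall m g, g < m <= n -> e m.+1 g <= e m g <= e m.+1 g.+1,
      forall m g, g.+2 < m <= n.+1 -> e m g < e m g.+2
    & forall g, g < n.+1 -> e n.+1 g = nth 0 k g].

Lemma nondecr_of_interlacing e m :
    (forall m g, g < m <= n -> e m.+1 g <= e m g <= e m.+1 g.+1) ->
    (forall g, g < n.+1 -> e n.+1 g = nth 0 k g) ->
  m <= n.+1 -> nondecr_row (e m) m.
Proof.
move=> inter bot; have [->|neq_m] := eqVneq m n.+1 => le_m.
  move=> g g' /andP[]; rewrite leq_eqVlt => /predU1P[->|lt_g] lt_g' //.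
  by rewrite !bot; [apply/ltnW/k_incr/andP | | ]; lia.
move=> g g'; elim: g' => [|g' IHg]; first by case: g.
case/andP; rewrite leq_eqVlt => /predU1P[->|] // lt_g lt_g'.
apply: (leq_trans (IHg _)); first lia.
have /andP[_ le1] : e m.+1 g' <= e m g' <= e m.+1 g'.+1 by apply: inter; lia.
have /andP[le2 _] : e m.+1 g'.+1 <= e m g'.+1 <= e m.+1 g'.+2 by apply: inter; lia.
exact: leq_trans le2.
Qed.

Lemma tf_pattern_nondecr e m : tf_pattern e -> m <= n.+1 -> nondecr_row (e m) m.
Proof. by case=> _ inter _ bot; apply: nondecr_of_interlacing. Qed.

Lemma tf_pattern_le2 e m t : tf_pattern e -> m <= n.+1 -> row_mult (e m) m t <= 2.
Proof.
move=> eP le_m; apply: row_mult_le2; first exact: tf_pattern_nondecr.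
by case: eP => _ _ e3 _ g lt_g; apply: e3; lia.
Qed.

Lemma tf_pattern_tail e m t : tf_pattern e -> m <= n.+1 -> t <= K ->
  tail_sum (mult (row_state K (e m) m)) t = row_above (e m) m t.
Proof.
move=> eP le_m le_t; apply: row_state_tail => // [s|g lt_g].
  exact: tf_pattern_le2.
by case: eP => /(_ m g); rewrite lt_g => /(_ le_m)/andP[].
Qed.

Lemma tf_pattern_interl e m t : tf_pattern e -> m <= n ->
  interl (row_above (e m.+1) m.+1 t) (row_above (e m) m t).
Proof.
case=> _ inter _ _ le_m; apply/andP; split.
  rewrite /row_above big_ord_recl; apply: leq_trans (leq_addl _ _).
  apply: leq_sum => g _; rewrite lift0.
  have /andP[_ le_e] : e m.+1 g <= e m g <= e m.+1 g.+1.
    by apply: inter; rewrite ltn_ord.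
  by case: ltnP => // /leq_trans/(_ le_e) ->.
rewrite /row_above big_ord_recr /= -[leqRHS]addn1; apply: leq_add; last exact: leq_b1.
apply: leq_sum => g _.
have /andP[le_e _] : e m.+1 g <= e m g <= e m.+1 g.+1.
  by apply: inter; rewrite ltn_ord.
by case: ltnP => // /leq_trans/(_ le_e) ->.
Qed.

Lemma tf_pattern_row_above0 e m : tf_pattern e -> m <= n.+1 -> row_above (e m) m 0 = m.
Proof.
case=> e0 _ _ _ le_m; rewrite -[RHS]card_ord -sum1_card; apply: eq_bigr => g _.
by have /andP[->] : 0 < e m g <= K by apply: e0; rewrite ltn_ord.
Qed.

(** The interlacing of two consecutive rows makes all indicators in the fused
    weights equal to 1. *)
Lemma tf_pattern_weight e m : tf_pattern e -> m <= n ->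
  row_weight (row_state K (e m.+1) m.+1) (row_state K (e m) m)
  = 2 ^ (\sum_(t < K) (0 < row_mult (e m) m t)).
Proof.
move=> eP le_m; have le_m' := leqW le_m.
rewrite /row_weight !tf_pattern_tail // !tf_pattern_row_above0 // eqxx mul1n expn_sum.
apply: eq_bigr => t _; rewrite !tf_pattern_tail //.
rewrite !row_state_mult ?tf_pattern_le2 // /fused_weight.
by rewrite ![row_above _ _ _ + _]addnC -!row_aboveS !tf_pattern_interl // mul1n.
Qed.

Lemma eq_row_state K f f' m :
  (forall g, g < m -> f g = f' g) -> row_state K f m = row_state K f' m.
Proof.
move=> eqf; apply/ffunP => t; rewrite !ffunE; congr inord.
by apply: eq_bigr => g _; rewrite eqf.
Qed.

(** The start and the end of the walks: the bottom row, and the row of size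
    0. *)
Definition bottom : mult_state K := row_state K (nth 0 k) n.+1.

Definition empty_row : mult_state K := [ffun => ord0].

(** The walk that encodes a pattern, through rows of decreasing size, bottom
    row excluded. *)
Definition rows (e : nat -> nat -> nat) : n.+1.-tuple (mult_state K) :=
  [tuple row_state K (e (n.+1 - i.+1)) (n.+1 - i.+1) | i < n.+1].

Lemma walk_rows e a : tf_pattern e -> a <= n.+1 ->
  walk bottom (rows e) a = row_state K (e (n.+1 - a)) (n.+1 - a).
Proof.
case=> _ _ _ bot le_a.
have -> : bottom = row_state K (e (n.+1 - 0)) (n.+1 - 0).
  by rewrite subn0; apply: eq_row_state => g lt_g; rewrite bot.
exact: (walk_mktuple (fun i => row_state K (e (n.+1 - i)) (n.+1 - i))).
Qed.

Lemma row_state0 f : row_state K f 0 = empty_row.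
Proof.
by apply/ffunP => t; apply: val_inj; rewrite !ffunE /row_mult big_ord0 /= inordK.
Qed.

Lemma path_weight_rows e : tf_pattern e ->
  path_weight (@row_weight K) empty_row bottom (rows e) =
  2 ^ (\sum_(m < n.+1) \sum_(t < K) (0 < row_mult (e m) m t)).
Proof.
move=> eP; rewrite path_weight_walk walk_rows // subnn row_state0 eqxx muln1.
rewrite (reindex_inj rev_ord_inj) expn_sum; apply: eq_bigr => i _ /=.
have lt_i := ltn_ord i.
rewrite !walk_rows //; try lia.
have -> : n.+1 - (n.+1 - i.+1) = i.+1 by lia.
have -> : n.+1 - (n.+1 - i.+1).+1 = i by lia.
by rewrite tf_pattern_weight.
Qed.

Lemma eq_by_lt x y : (forall t, (t < x) = (t < y)) -> x = y.
Proof. by move=> xy; have := xy x; have := xy y; lia. Qed.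

Lemma rows_inj e e' m g : tf_pattern e -> tf_pattern e' -> rows e = rows e' ->
  g < m <= n.+1 -> e m g = e' m g.
Proof.
move=> eP e'P eqr /andP[lt_g le_m].
have eqs : row_state K (e m) m = row_state K (e' m) m.
  have := walk_rows eP (leq_subr m n.+1); have := walk_rows e'P (leq_subr m n.+1).
  by rewrite eqr subKn // => -> ->.
apply: eq_by_lt => t; have [le_t|lt_t] := leqP t K.
  rewrite !(@row_aboveP _ m) //; try exact: tf_pattern_nondecr.
  by rewrite -!tf_pattern_tail // eqs.
have /andP[_] : 0 < e m g <= K by case: eP => + _ _ _; apply; rewrite lt_g.
have /andP[_] : 0 < e' m g <= K by case: e'P => + _ _ _; apply; rewrite lt_g.
by lia.
Qed.

Lemma bottom_tail t : t <= K -> tail_sum (mult bottom) t = row_above (nth 0 k) n.+1 t.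
Proof.
apply: row_state_tail => [s|]; last exact: k_leK.
apply: row_mult_le2 => [g g' /andP[]|g lt_g]; last by apply: k_incr; lia.
rewrite leq_eqVlt => /predU1P[-> //|lt_g lt_g'].
by apply/ltnW/k_incr/andP.
Qed.

(** A walk of nonzero weight is the encoding of a pattern: the entry g of the
    row of size m is the number of thresholds t with more than m - g - 1
    entries above t. *)
Lemma rows_onto (p : n.+1.-tuple (mult_state K)) :
  path_weight (@row_weight K) empty_row bottom p != 0 ->
  exists2 e, tf_pattern e & rows e = p.
Proof.
rewrite path_weight_walk muln_eq0 negb_or => /andP[].
rewrite eqb0 negbK => pw /eqP p_end.
pose N a t := tail_sum (mult (walk bottom p a)) t.
have {pw} step a : a < n.+1 -> row_weight (walk bottom p a) (walk bottom p a.+1) != 0.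
  move=> lt_a; apply: contraNneq pw => w0; rewrite (bigD1 (Ordinal lt_a)) //=.
  by rewrite w0.
have start a : a < n.+1 -> N a 0 = (N a.+1 0).+1.
  move=> /step; rewrite /row_weight muln_eq0 negb_or eqb0 negbK.
  by case/andP=> /eqP.
have N_end a t : K <= t -> N a t = 0 by move=> le_t; apply: tail_sum_ge.
have inter a t : a < n.+1 -> interl (N a t) (N a.+1 t).
  move=> lt_a; have [le_K|lt_t] := leqP K t; first by rewrite !N_end.
  have := step a lt_a; rewrite /row_weight muln_eq0 negb_or => /andP[_].
  rewrite (bigD1 (Ordinal lt_t)) // muln_eq0 negb_or => /andP[+ _].
  rewrite /fused_weight muln_eq0 eqb0 negb_or negbK => /andP[/andP[_ i0] _].
  have Nt b : N b t = mult (walk bottom p b) (Ordinal lt_t) + N b t.+1.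
    exact: (tail_sumE _ (Ordinal lt_t)).
  by rewrite !Nt ![mult _ _ + _]addnC.
(* The length of the row drops by 1 in each step and is 0 at the end. *)
have N0 m : m <= n.+1 -> N (n.+1 - m) 0 = m.
  elim: m => [_|m IHm lt_m].
    rewrite subn0 /N p_end /tail_sum big1 // => t _; by rewrite /mult ffunE.
  rewrite start; last lia.
  by rewrite subnS prednK ?subn_gt0 // IHm // ltnW.
pose e m g := \sum_(t < K) (m <= N (n.+1 - m) t + g).
(* Duality again; beyond the threshold K both sides are false. *)
have e_lt m g t : g < m -> (t < e m g) = (m <= N (n.+1 - m) t + g).
  move=> lt_g; have [le_K|lt_t] := leqP K t.
    rewrite N_end // add0n [RHS]leqNgt lt_g /= ltnNge -[RHS]negbK; congr (~~ _).
    apply: leq_trans le_K; rewrite -[leqRHS]card_ord -sum1_card.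
    by apply: leq_sum => i _; exact: leq_b1.
  apply/esym/(@count_down_closed (fun t => m <= N (n.+1 - m) t + g) K) => //.
  move=> s s' /andP[le_s _] /leq_trans -> //.
  by rewrite leq_add2r; apply: leq_tail_sum.
have e_leK m g : e m g <= K.
  rewrite -[leqRHS]card_ord -sum1_card.
  by apply: leq_sum => i _; exact: leq_b1.
have eP : tf_pattern e.
  split=> [m g /andP[lt_g le_m]|m g /andP[lt_g le_m]|m g /andP[lt_g le_m]|g lt_g].
  - by rewrite e_leK andbT e_lt // N0 // leq_addr.
  - have := inter (n.+1 - m.+1); rewrite subnSK // => int.
    apply/andP; split; rewrite leqNgt; apply/negP.
      rewrite e_lt; last lia.
      move=> lt1; have := int (e m g); have := e_lt m g (e m g) lt_g.
      by rewrite ltnn /interl; lia.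
    rewrite e_lt // => lt1.
    have := int (e m.+1 g.+1); have := e_lt m.+1 g.+1 (e m.+1 g.+1) lt_g.
    by rewrite ltnn /interl; lia.
  - rewrite ltnNge; apply/negP => le_e.
    have e_gt0 : 0 < e m g.+2 by rewrite e_lt // N0 // leq_addr.
    pose s := (e m g.+2).-1.
    have lt_s : s < K by have := e_leK m g.+2; rewrite /s; lia.
    have : s < e m g by rewrite /s; lia.
    have := ltnn (e m g.+2); rewrite !e_lt //; try lia.
    rewrite -[X in N _ X + g.+2](prednK e_gt0) -/s.
    have : N (n.+1 - m) s = mult (walk bottom p (n.+1 - m)) (Ordinal lt_s) + N (n.+1 - m) s.+1.
      exact: (tail_sumE _ (Ordinal lt_s)).
    have : mult (walk bottom p (n.+1 - m)) (Ordinal lt_s) <= 2 by rewrite -ltnS /mult.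
    by lia.
  - apply: eq_by_lt => t; rewrite e_lt // subnn.
    have [le_t|lt_t] := leqP t K; last first.
      by rewrite N_end ?(ltnW lt_t) //; have := k_leK lt_g; lia.
    rewrite /N /= bottom_tail // -row_aboveP // => g1 g2 /andP[].
    rewrite leq_eqVlt => /predU1P[-> //|lt_g1 lt_g2].
    by apply/ltnW/k_incr/andP.
exists e => //; apply: eq_from_tnth => i; rewrite tnth_mktuple.
have lt_i := ltn_ord i; set m := n.+1 - i.+1.
have le_m : m <= n.+1 by rewrite /m; lia.
have -> : tnth p i = walk bottom p (n.+1 - m).
  rewrite (tnth_nth bottom) /m (_ : n.+1 - (n.+1 - i.+1) = i.+1) //; lia.
have tailE t : t <= K -> row_above (e m) m t = N (n.+1 - m) t.
  move=> le_t; have le_N : N (n.+1 - m) t <= m.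
    by rewrite -[leqRHS](N0 m) //; apply: leq_tail_sum.
  transitivity (\sum_(g < m) (m - N (n.+1 - m) t <= g)).
    by apply: eq_bigr => g _; rewrite e_lt // leq_subLR.
  by rewrite sum_geq subKn.
apply/ffunP => t; apply: val_inj; rewrite ffunE /= inordK; last first.
  by rewrite ltnS tf_pattern_le2.
have := row_aboveS (e m) m t; rewrite !tailE //; last exact: ltnW.
rewrite /N (tail_sumE _ t) => /addIn; rewrite /mult => -> //.
Qed.

End Patterns.

Section Cells.
Variable n : nat.
Implicit Types (a b : tri n.+1).

Definition corner : tri n.+1 := Sub (ord0, ord0) isT.

(** The position in row r and column g, counted from 0; meaningful for
    g <= r <= n. *)
Definition cell (r g : nat) : tri n.+1 := insubd corner (inord r, inord g).

Lemma cellE r g : g <= r <= n -> val (cell r g) = (inord r, inord g).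
Proof.
move=> /andP[le_g le_r]; rewrite val_insubd /= !inordK ?ltnS ?le_g //.
exact: leq_trans le_r.
Qed.

Lemma trow_cell r g : g <= r <= n -> trow (cell r g) = r :> nat.
Proof. by move=> rP; rewrite /trow cellE //= inordK //; lia. Qed.

Lemma tcol_cell r g : g <= r <= n -> tcol (cell r g) = g :> nat.
Proof. by move=> rP; rewrite /tcol cellE //= inordK //; lia. Qed.

Lemma tri_bound a : tcol a <= trow a <= n.
Proof. by rewrite -[trow a <= n]ltnS ltn_ord andbT; exact: (valP a). Qed.

Lemma tri_eq a b : trow a = trow b :> nat -> tcol a = tcol b :> nat -> a = b.
Proof.
move=> eq_r eq_c; apply: val_inj; rewrite [val a]surjective_pairing.
by rewrite [val b]surjective_pairing; congr (_, _); apply: val_inj.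
Qed.

Lemma cellK a : cell (trow a) (tcol a) = a.
Proof. by apply: tri_eq; rewrite ?trow_cell ?tcol_cell // tri_bound. Qed.

Lemma sum_tri (F : tri n.+1 -> nat) :
  \sum_a F a = \sum_(r < n.+1) \sum_(g < r.+1) F (cell r g).
Proof.
rewrite (partition_big (@trow n.+1) xpredT) //=; apply: eq_bigr => r _.
rewrite (reindex_onto (fun g : 'I_r.+1 => cell r g) (fun a => inord (tcol a))) /=.
  apply: eq_bigl => g; have gr : g <= r <= n by apply/andP; split; rewrite -ltnS.
  rewrite tcol_cell // inord_val eqxx andbT; apply/eqP/val_inj.
  by rewrite /= trow_cell.
move=> a /eqP <-; rewrite inordK ?cellK //.
by have /andP[] := tri_bound a.
Qed.

(** The array T as a function of the size of the row and of the column. *)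
Definition entry (T : {ffun tri n.+1 -> int}) (m g : nat) : nat :=
  absz (T (cell m.-1 g)).

(** Conversely, the array with given entries. *)
Definition array (e : nat -> nat -> nat) : {ffun tri n.+1 -> int} :=
  [ffun a => Posz (e (trow a).+1 (tcol a))].

Lemma entry_array e m g : g < m <= n.+1 -> entry (array e) m g = e m g.
Proof.
case: m => // m mP; rewrite /entry ffunE /= trow_cell ?tcol_cell //; lia.
Qed.
End Cells.

Section TripleFree.
Variables (n : nat) (k : n.+1.-tuple nat).
Local Notation K := (last 0 k).
Hypothesis k_gt0 : forall g, g < n.+1 -> 0 < nth 0 k g.
Hypothesis k_leK : forall g, g < n.+1 -> nth 0 k g <= K.
Hypothesis k_incr : forall g g', g < g' < n.+1 -> nth 0 k g < nth 0 k g'.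
Implicit Types (T : {ffun tri n.+1 -> int}) (e : nat -> nat -> nat).

Lemma array_is_tfGT e : tf_pattern k e -> is_tfGT k (array n e).
Proof.
case=> _ inter e3 bot; apply/and3P; split.
- apply/forallP => a; apply/forallP => b; rewrite !ffunE !lez_nat.
  have := tri_bound a; have := tri_bound b => bP aP.
  have le_e : trow b = (trow a).+1 :> nat ->
      e (trow a).+2 (tcol a) <= e (trow a).+1 (tcol a) <= e (trow a).+2 (tcol a).+1.
    by move=> rE; apply: inter; lia.
  apply/andP; split; apply/implyP => /andP[/eqP rE /eqP cE];
    by have /andP[] := le_e (esym rE); rewrite -rE -cE.
- apply/existsP => -[a /existsP[b /existsP[c /and4P[]]]].
  move=> /andP[/eqP ab /eqP ab'] /andP[/eqP bc /eqP bc'].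
  have := tri_bound c; rewrite -bc' -ab' -bc -ab => cP.
  rewrite !ffunE -bc' -ab' -bc -ab !eqz_nat => /eqP e_ab /eqP e_bc.
  have := e3 (trow a).+1 (tcol a); rewrite e_ab e_bc ltnn => H.
  suff : false by []. apply: H; lia.
apply/forallP => a; apply/implyP => /eqP a_end; rewrite ffunE eqz_nat.
by rewrite a_end bot // -tnth_nth.
Qed.

Lemma tfGT_ge0 T a : is_tfGT k T -> (0 <= T a)%R.
Proof. by move=> /(tfGT_bound a)/andP[]. Qed.

Lemma tfGT_entryE T r g : is_tfGT k T -> T (cell n r g) = Posz (entry T r.+1 g).
Proof. by move=> TP; rewrite /entry /= gez0_abs // tfGT_ge0. Qed.

Lemma entry_is_pattern T : is_tfGT k T -> tf_pattern k (entry T).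
Proof.
move=> TP; have /and3P[gtT tf botT] := TP.
have inter m g : g < m <= n ->
    entry T m.+1 g <= entry T m g <= entry T m.+1 g.+1.
  case: m => // m mP.
  have /forallP/(_ (cell n m g))/forallP gtm := gtT.
  rewrite -2!lez_nat -!tfGT_entryE //; apply/andP; split.
    have /andP[/implyP + _] := gtm (cell n m.+1 g); apply.
    by rewrite /upper_right -!(inj_eq val_inj) /= !trow_cell ?tcol_cell ?eqxx //; lia.
  have /andP[_ /implyP +] := gtm (cell n m.+1 g.+1); apply.
  by rewrite /upper_left /= !trow_cell ?tcol_cell ?eqxx //; lia.
have bot g : g < n.+1 -> entry T n.+1 g = nth 0 k g.
  move=> lt_g; apply/eqP; rewrite -eqz_nat -tfGT_entryE //.
  have /forallP/(_ (cell n n g)) := botT; rewrite trow_cell ?leqnn ?andbT // eqxx /=.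
  by rewrite (tnth_nth 0) tcol_cell ?leqnn ?andbT.
split=> // [m g /andP[lt_g le_m]|m g /andP[lt_g le_m]].
  apply/andP; split.
    move: m le_m lt_g; apply: down_ind => [lt_g|m IHm lt_g]; first by rewrite bot // k_gt0.
    have mP : g < m <= n by rewrite lt_g -ltnS ltn_ord.
    have /andP[+ _] := inter m g mP; apply: leq_trans; apply: IHm; exact: ltnW.
  case: m lt_g le_m => // m lt_g le_m; rewrite -lez_nat -tfGT_entryE //.
  have /andP[_ le_T] := tfGT_bound (cell n m g) TP.
  apply: Order.POrderTheory.le_trans le_T _; rewrite lez_nat.
  rewrite big_seq; elim/big_ind: _ => // [x y|x /(nthP 0)[g' lt_g' <-]].
    by rewrite geq_max => -> ->.
  by apply: k_leK; rewrite size_tuple in lt_g'.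
have mono := nondecr_of_interlacing k_incr inter bot le_m.
rewrite ltnNge; apply/negP => le_e; move/negP: tf; apply.
have le1 : entry T m g <= entry T m g.+1 by apply: mono; lia.
have le2 : entry T m g.+1 <= entry T m g.+2 by apply: mono; lia.
case: m lt_g le_m le_e {mono} le1 le2 => // m lt_g le_m le_e le1 le2.
apply/existsP; exists (cell n m g); apply/existsP; exists (cell n m g.+1).
apply/existsP; exists (cell n m g.+2); rewrite /right_of.
rewrite -!(inj_eq val_inj) /= !trow_cell ?tcol_cell ?eqxx /=; try lia.
by rewrite !tfGT_entryE // !eqz_nat; lia.
Qed.

Lemma exists_upper_left T r g : is_tfGT k T -> g <= r <= n ->
  [exists a, upper_left a (cell n r g) && (T a == T (cell n r g))] =
  (0 < g) && (entry T r g.-1 == entry T r.+1 g).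
Proof.
move=> TP rP; rewrite (tfGT_entryE r g TP); apply/existsP/idP.
  case=> a /andP[/andP[/eqP + /eqP +] /eqP]; rewrite trow_cell // tcol_cell //.
  move=> rE gE; have := tfGT_entryE (trow a) (tcol a) TP; rewrite cellK => ->.
  by rewrite -rE -gE /= => -[->].
case: g rP => // g; case: r => // r rP /= /eqP eq_e; exists (cell n r g).
rewrite tfGT_entryE // eq_e eqxx andbT /upper_left.
by rewrite !trow_cell ?tcol_cell ?eqxx //; lia.
Qed.

Lemma exists_upper_right T r g : is_tfGT k T -> g <= r <= n ->
  [exists a, upper_right a (cell n r g) && (T a == T (cell n r g))] =
  (g < r) && (entry T r g == entry T r.+1 g).
Proof.
move=> TP rP; rewrite (tfGT_entryE r g TP); apply/existsP/idP.
  case=> a /andP[/andP[/eqP + /eqP +] /eqP]; rewrite trow_cell //.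
  move=> rE /(congr1 val) /=; rewrite tcol_cell // => gE.
  have := tfGT_entryE (trow a) (tcol a) TP; rewrite cellK => ->.
  have /andP[le_g _] := tri_bound a.
  by rewrite -rE -gE => -[->]; rewrite ltnS le_g eqxx.
case: r rP => // r rP /andP[lt_g /eqP eq_e]; exists (cell n r g).
rewrite tfGT_entryE // eq_e eqxx andbT /upper_right -(inj_eq val_inj) /=.
by rewrite !trow_cell ?tcol_cell ?eqxx //; lia.
Qed.

Lemma FSA_exponentE T : is_tfGT k T ->
  FSA_exponent T =
  n.+1 + \sum_(m < n.+1) \sum_(t < K) (0 < row_mult (entry T m) m t).
Proof.
move=> TP; have eP := entry_is_pattern TP; have [e0 inter _ _] := eP.
rewrite /FSA_exponent card_pred_sum sum_tri.
rewrite -[X in X + _]card_ord -sum1_card -big_split /=; apply: eq_bigr => r _.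
have le_r : r <= n by rewrite -ltnS.
rewrite (eq_bigr (fun g : 'I_r.+1 =>
    [|| (g : nat) == 0, (g : nat) == r | entry T r g.-1 != entry T r g] : nat)); last first.
  move=> g _; have rP : g <= r <= n by rewrite le_r -ltnS ltn_ord.
  rewrite /equals_both_upper exists_upper_left // exists_upper_right //.
  case: (posnP g) => [-> //|g_gt0] /=.
  have [->|neq_g] := eqVneq (g : nat) r; first by rewrite ltnn andbF.
  have lt_g : g < r by lia.
  rewrite lt_g /=; congr nat_of_bool.
  have /andP[le1 le2] : entry T r.+1 g.-1.+1.-1 <= entry T r g.-1 <= entry T r.+1 g.-1.+1.
    by apply: inter; lia.
  have /andP[le3 _] : entry T r.+1 g <= entry T r g <= entry T r.+1 g.+1.
    by apply: inter; lia.
  move: le2; rewrite prednK // => le2.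
  by case: eqP; case: eqP; case: eqP; lia.
case: (nat_of_ord r) le_r => [|m] le_m.
  by rewrite big_ord_recl !big_ord0 big1 // => t _; rewrite /row_mult big_ord0.
rewrite distinct_row; first last.
- by move=> g le_g; apply: e0; lia.
- by apply: (tf_pattern_nondecr k_incr); rewrite // ltnW.
rewrite big_ord_recl big_ord_recr /= eqxx addn1; congr (_ + _.+1).
apply: eq_bigr => g _; rewrite /bump leq0n add1n add0n.
by rewrite eqSS (ltn_eqF (ltn_ord g)).
Qed.

End TripleFree.

(** * Equality of the partition functions *)

Import Order.TTheory GRing.Theory Num.Theory.
Local Open Scope ring_scope.

Section Main.
Variables (n : nat) (k : n.+1.-tuple nat).
Local Notation K := (last 0%N k).
Hypothesis k_gt0 : forall g, (g < n.+1 -> 0 < nth 0 k g)%N.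
Hypothesis k_leK : forall g, (g < n.+1 -> nth 0 k g <= K)%N.
Hypothesis k_incr : forall g g', (g < g' < n.+1 -> nth 0 k g < nth 0 k g')%N.

(** The fused west boundary is the bottom row: the entries of k are distinct,
    and each of them corresponds to one odd row. *)
Lemma fuse_west : fuse (west k) = bottom k.
Proof.
have k_uniq : uniq k.
  apply/(uniqP 0%N) => i j; rewrite !inE size_tuple => lt_i lt_j eq_k.
  case: (ltngtP i j) => // lt_ij.
    by have := @k_incr i j; rewrite lt_ij lt_j eq_k ltnn => /(_ isT).
  by have := @k_incr j i; rewrite lt_ij lt_i eq_k ltnn => /(_ isT).
apply/ffunP => t; rewrite !ffunE /occ ffunE /= addn0; congr inord.
rewrite -(count_uniq_mem _ k_uniq) -sum1_count (big_nth 0%N) size_tuple.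
by rewrite big_mkord big_mkcond.
Qed.

Lemma fuse_empty (l : col_state K) : (fuse l == @empty_row _ k) = (l == empty_column k).
Proof.
rewrite fuse_eqP; apply/forallP/eqP => [l0|-> t]; last by rewrite !ffunE.
apply/ffunP => t; have := l0 t; rewrite !ffunE.
by case: (l t) => -[] [].
Qed.

Lemma partition_functions :
  (\sum_(x : mixed6V k) 2 ^ inv_tilde x =
   \sum_(T : tfGT k) 2 ^ (FSA_exponent T - n.+1))%N.
Proof.
have K_gt0 : (0 < K)%N by apply: leq_trans (k_leK (ltn0Sn n)); apply: k_gt0.
have k_pos m : m \in k -> (0 < m)%N.
  by move=> /(nthP 0%N)[g lt_g <-]; apply: k_gt0; rewrite size_tuple in lt_g.
have k_max m : m \in k -> (m <= K)%N.
  by move=> /(nthP 0%N)[g lt_g <-]; apply: k_leK; rewrite size_tuple in lt_g.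
transitivity (path_sum (@col_weight K) (empty_column k) n.+1 (west k)).
  apply: (sum_injective_support (h := fun x : mixed6V k => columns (val x))).
  - move=> x y eq_xy; apply: val_inj.
    exact: (columns_inj K_gt0 k_pos k_max (valP x) (valP y)).
  - by move=> x; apply: path_weight_columns.
  - move=> p /(columns_onto K_gt0 k_pos k_max)[c cP <-].
    by exists (Sub c cP); rewrite SubK.
rewrite (path_sum_lump _ _ (@sum_col_weight K) fuse_empty) fuse_west.
apply/esym/(sum_injective_support (h := fun T : tfGT k => rows k (entry (val T)))).
- move=> T T' eq_TT'; have TP := valP T; have TP' := valP T'; apply: val_inj.
  have eP := entry_is_pattern k_gt0 k_leK k_incr TP.
  have eP' := entry_is_pattern k_gt0 k_leK k_incr TP'.
  apply/ffunP => a; rewrite -(cellK a) (tfGT_entryE _ _ TP) (tfGT_entryE _ _ TP'); congr Posz.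
  by apply: (rows_inj k_incr eP eP' eq_TT'); rewrite ltnS; exact: tri_bound.
- move=> T; have TP := valP T.
  have eP := entry_is_pattern k_gt0 k_leK k_incr TP.
  by rewrite path_weight_rows // (FSA_exponentE k_gt0 k_leK k_incr) // addKn.
move=> p /(rows_onto k_leK k_incr)[e eP <-].
exists (Sub (array n e) (array_is_tfGT eP)); rewrite SubK.
apply: eq_from_tnth => i; rewrite !tnth_mktuple; apply: eq_row_state => g lt_g.
by rewrite entry_array // lt_g subSS leqW // leq_subr.
Qed.

Lemma FSA_exponent_ge (T : tfGT k) : (n.+1 <= FSA_exponent T)%N.
Proof. by rewrite (FSA_exponentE k_gt0 k_leK k_incr (valP T)) leq_addr. Qed.
End Main.

(** * Probabilistic bijections *)

Lemma prob_bijection_of_eq_sums (R : numFieldType) (X Y : finType)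
    (wX : X -> R) (wY : Y -> R) :
    (forall x, 0 < wX x) -> (forall y, 0 < wY y) ->
    \sum_x wX x = \sum_y wY y ->
  exists P Pbar : X -> Y -> R, prob_bijection wX wY P Pbar.
Proof.
move=> wX_gt0 wY_gt0 eqZ; set Z := \sum_x wX x in eqZ.
have ZX (x : X) : Z != 0.
  by rewrite gt_eqF // /Z (bigD1 x) //= ltr_wpDr // sumr_ge0 // => x' _; exact/ltW.
have ZY (y : Y) : Z != 0.
  by rewrite gt_eqF // eqZ (bigD1 y) //= ltr_wpDr // sumr_ge0 // => y' _; exact/ltW.
exists (fun _ y => wY y / Z), (fun x _ => wX x / Z); split=> [x|y|x y].
- by rewrite -mulr_suml -eqZ divff // (ZX x).
- by rewrite -mulr_suml divff // (ZY y).
- by rewrite mulrA mulrAC.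
Qed.

Theorem corollary5p3 (R : realType) (n : nat) (k : n.-tuple nat)
    (n_ge1 : (1 <= n)%N)
    (k_pos : forall i : 'I_n, (0 < tnth k i)%N)
    (k_incr : forall i j : 'I_n, (i < j)%N -> (tnth k i < tnth k j)%N) :
  exists P Pbar : mixed6V k -> tfGT k -> R,
    prob_bijection (fun x : mixed6V k => 2 ^+ inv_tilde x)
                   (fun T : tfGT k => 2 ^- n * omega_FSA R T)
                   P Pbar.
Proof.
case: n k n_ge1 k_pos k_incr => // n k _ k_pos k_incr.
have kg0 g : (g < n.+1 -> 0 < nth 0 k g)%N.
  by move=> lt_g; have := k_pos (Ordinal lt_g); rewrite (tnth_nth 0%N).
have kincr g g' : (g < g' < n.+1 -> nth 0 k g < nth 0 k g')%N.
  move=> /andP[lt_gg' lt_g'].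
  have := k_incr (Ordinal (ltn_trans lt_gg' lt_g')) (Ordinal lt_g') lt_gg'.
  by rewrite !(tnth_nth 0%N).
have kleK g : (g < n.+1 -> nth 0 k g <= last 0 k)%N.
  rewrite -nth_last size_tuple ltnS leq_eqVlt => /predU1P[-> //|lt_g].
  by apply/ltnW/kincr; rewrite lt_g /=.
have wE (T : tfGT k) : 2 ^- n.+1 * omega_FSA R T = (2 ^ (FSA_exponent T - n.+1))%:R.
  rewrite /omega_FSA natrX -{1}(subnKC (FSA_exponent_ge kg0 kleK kincr T)) exprD.
  by rewrite mulKf // expf_neq0 // pnatr_eq0.
apply: prob_bijection_of_eq_sums => [x|T|].
- exact: exprn_gt0.
- by rewrite wE ltr0n expn_gt0.
under [RHS]eq_bigr do rewrite wE.
rewrite -natr_sum -(partition_functions kg0 kleK kincr) natr_sum.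
by apply: eq_bigr => x _; rewrite natrX.
Qed.
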